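(* The map $\mu:\mathbb{P}(n)\times\mathbb{P}(n)\to\mathbb{P}(n)$, $\mu(A,B)=A*B$, satisfies: (1) $A*B$ is a $d_\infty$-midpoint of $A$ and $B$, i.e. $d_\infty(A,A*B)=d_\infty(A*B,B)=\tfrac12 d_\infty(A,B)$; (2) $\mu$ is continuous; (3) $\mu(A,B)=\mu(B,A)$ for all $A,B\in\mathbb{P}(n)$; (4) $\mu(XAX^*,XBX^* )=X\mu(A,B)X^*$ for all $A,B\in\mathbb{P}(n)$ and all invertible $n\times n$ complex matrices $X$; (5) $(aA)*(bB)=\sqrt{ab}\,(A*B)$ for all real $a,b>0$ and $A,B\in\mathbb{P}(n)$; (6) if $A\preceq B$ then $A\preceq\mu(A,B)\preceq B$; (7) if $\Sigma_1\preceq\Sigma_2$ in $\mathbb{P}(n)$, then $\lambda_{\max}(\mu(I,\Sigma_1))\le\lambda_{\max}(\mu(I,\Sigma_2))$ and $\lambda_{\min}(\mu(I,\Sigma_1))\le\lambda_{\min}(\mu(I,\Sigma_2))$.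
   Context: $\mathbb{P}(n)$ denotes the cone of $n\times n$ positive definite Hermitian matrices; $X^*$ is the conjugate transpose; $\preceq$ is the Löwner order ($A\preceq B$ iff $B-A$ is positive semidefinite). The Thompson metric is $d_{\infty}(A,B)=\|\log A^{-1/2}BA^{-1/2}\|_{\infty}=\max\{\log\lambda_{\max}(BA^{-1}),\log\lambda_{\max}(AB^{-1})\}$. For $A,B\in\mathbb{P}(n)$, with $\lambda_{\max},\lambda_{\min}$ the largest and smallest eigenvalues of $BA^{-1}$, define $A*B=\frac{1}{\sqrt{\lambda_{\min}}+\sqrt{\lambda_{\max}}}\left(B+\sqrt{\lambda_{\min}\lambda_{\max}}\,A\right)$. *)

(* Defs.v *)
From HB Require Import structures.
From mathcomp Require Import all_boot all_order all_algebra.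
From mathcomp Require Import all_classical all_reals all_analysis.
From mathcomp Require Import complex.
Set Implicit Arguments. Unset Strict Implicit. Unset Printing Implicit Defensive.
Import Order.TTheory GRing.Theory Num.Theory.
Import numFieldNormedType.Exports.
Local Open Scope ring_scope.
Local Open Scope complex_scope.

Section Defs.
Variables (R : realType) (n : nat).
Local Notation C := R[i].

Definition ctr (X : 'M[C]_n) : 'M[C]_n := (map_mx conjc X)^T.

Definition hermitian (M : 'M[C]_n) : Prop := ctr M = M.

Definition posdef (M : 'M[C]_n) : Prop :=
  hermitian M /\
  forall v : 'cV[C]_n, v != 0 -> 0 < ((map_mx conjc v)^T *m M *m v) 0 0.

Definition psd (M : 'M[C]_n) : Prop :=
  hermitian M /\
  forall v : 'cV[C]_n, 0 <= ((map_mx conjc v)^T *m M *m v) 0 0.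

Definition loewner (A B : 'M[C]_n) : Prop := psd (B - A).

(* real eigenvalues of a complex matrix (the matrices considered here,
   B A^{-1} and elements of P(n), have real spectrum) *)
Definition rspec (M : 'M[C]_n) : set R := [set x : R | eigenvalue M x%:C].

Definition lmax (M : 'M[C]_n) : R := sup (rspec M).
Definition lmin (M : 'M[C]_n) : R := inf (rspec M).

Definition dinf (A B : 'M[C]_n) : R :=
  Num.max (ln (lmax (B *m invmx A))) (ln (lmax (A *m invmx B))).

Definition mstar (A B : 'M[C]_n) : 'M[C]_n :=
  let lM := lmax (B *m invmx A) in
  let lm := lmin (B *m invmx A) in
  ((Num.sqrt lm + Num.sqrt lM)^-1)%:C *: (B + (Num.sqrt (lm * lM))%:C *: A).

End Defs.

(* Main.v *)
(* Two positive definite matrices are simultaneously congruent to the identity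
   and a positive diagonal matrix: A = P P^*, B = P diag(d) P^*. The spectrum of
   B A^-1 is then the set of the d_i, and A * B = P diag(f d) P^* where f is
   increasing and affine, with f(lmin) = sqrt lmin and f(lmax) = sqrt lmax. This
   gives the midpoint property, betweenness and, since lmax (B A^-1) <= t iff
   B <= t A in the Loewner order, the monotonicity of eigenvalues.

   For continuity, tr ((A A0^-1 - 1)^2) = sum_i (d_i - 1)^2, with d_i the
   eigenvalues of A A0^-1, is a polynomial in the entries of A that vanishes at
   A0. Hence for each t > 1, A0 <= t A and A <= t A0 for A close to A0, and this
   controls lmax (B A^-1) and lmin (B A^-1) up to a factor t^2. *)

Require Import Defs.
From HB Require Import structures.
From mathcomp Require Import all_boot all_order all_algebra.
From mathcomp Require Import all_classical all_reals all_analysis.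
From mathcomp Require Import complex spectral sesquilinear ring lra.
Import Order.TTheory GRing.Theory Num.Theory.
Import numFieldNormedType.Exports.
Local Open Scope ring_scope.
Local Open Scope complex_scope.
Local Open Scope classical_set_scope.

Set Implicit Arguments.
Unset Strict Implicit.
Unset Printing Implicit Defensive.

(** * Conjugate transposes, congruences and real diagonal matrices *)

Section ComplexMatrices.
Variable R : realType.
Local Notation C := R[i].
Local Notation hermitian := Defs.hermitian.

(** Real entries given by a function: identities between such matrices reduce to pointwise
    identities in [R]. *)
Definition rdiag n (d : 'I_n -> R) : 'M[C]_n := diag_mx (\row_j (d j)%:C).

Section Dim.
Variable n : nat.
Implicit Types (A B M P X : 'M[C]_n) (d a b : 'I_n -> R) (t : R).

Lemma ctrM X M : ctr (X *m M) = ctr M *m ctr X.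
Proof. by rewrite /ctr map_mxM trmx_mul. Qed.

Lemma ctrK X : ctr (ctr X) = X.
Proof. by apply/matrixP => i j; rewrite !mxE conjcK. Qed.

Lemma ctr_unitmx X : (ctr X \in unitmx) = (X \in unitmx).
Proof. by rewrite /ctr unitmx_tr map_unitmx. Qed.

Lemma ctr_invmx X : ctr (invmx X) = invmx (ctr X).
Proof. by rewrite /ctr map_invmx trmx_inv. Qed.

Lemma congrK X M : X \in unitmx ->
  invmx X *m (X *m M *m ctr X) *m ctr (invmx X) = M.
Proof.
move=> uX; have uX' : ctr X \in unitmx by rewrite ctr_unitmx.
by rewrite ctr_invmx !mulmxA (mulVmx uX) mul1mx (mulmxK uX').
Qed.

Lemma congrVK X M : X \in unitmx ->
  X *m (invmx X *m M *m ctr (invmx X)) *m ctr X = M.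
Proof.
by move=> uX; have := @congrK (invmx X) M; rewrite invmxK unitmx_inv; apply.
Qed.

Lemma ctr_rdiag d : ctr (rdiag d) = rdiag d.
Proof.
rewrite /ctr /rdiag map_diag_mx tr_diag_mx; congr diag_mx.
apply/rowP => i; rewrite !mxE; exact: conjc_real.
Qed.

Lemma rdiagM a b : rdiag a *m rdiag b = rdiag (fun i => a i * b i).
Proof.
rewrite /rdiag mulmx_diag; congr diag_mx.
by apply/rowP => i; rewrite !mxE rmorphM.
Qed.

Lemma rdiagD a b : rdiag a + rdiag b = rdiag (fun i => a i + b i).
Proof.
rewrite /rdiag -raddfD; congr diag_mx.
by apply/rowP => i; rewrite !mxE rmorphD.
Qed.

Lemma rdiagZ t a : t%:C *: rdiag a = rdiag (fun i => t * a i).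
Proof.
rewrite /rdiag -linearZ; congr diag_mx.
by apply/rowP => i; rewrite !mxE rmorphM.
Qed.

Lemma rdiagB a b : rdiag a - rdiag b = rdiag (fun i => a i - b i).
Proof.
rewrite /rdiag -raddfB; congr diag_mx.
by apply/rowP => i; rewrite !mxE rmorphB.
Qed.

Lemma rdiag1 : rdiag (fun=> 1) = 1%:M :> 'M[C]_n.
Proof.
rewrite /rdiag -diag_const_mx; congr diag_mx.
by apply/rowP => i; rewrite !mxE.
Qed.

Lemma eq_rdiag a b : a =1 b -> rdiag a = rdiag b.
Proof. by move=> ab; congr diag_mx; apply/rowP => i; rewrite !mxE ab. Qed.

Lemma rdiag_mulV d : (forall i, d i != 0) ->
  rdiag d *m rdiag (fun i => (d i)^-1) = 1%:M.
Proof. by move=> d0; rewrite rdiagM -rdiag1; apply: eq_rdiag => i; rewrite divff. Qed.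

(** * Quadratic forms and positivity under congruence *)

Definition qform M (v : 'cV[C]_n) : C := ((map_mx conjc v)^T *m M *m v) 0 0.

Lemma qform_congr X M v : qform (X *m M *m ctr X) v = qform M (ctr X *m v).
Proof.
by rewrite /qform map_mxM trmx_mul -[(map_mx _ (ctr X))^T]/(ctr (ctr X)) ctrK !mulmxA.
Qed.

Lemma qform_rdiag d v :
  qform (rdiag d) v = \sum_i (d i)%:C * ((v i 0) * (v i 0)^*).
Proof.
rewrite /qform mxE; apply: eq_bigr => i _.
by rewrite mul_mx_diag !mxE mulrAC mulrC [X in _ * X = _]mulrC.
Qed.

Lemma hermitian_congr X M : hermitian M -> hermitian (X *m M *m ctr X).
Proof. by rewrite /Defs.hermitian !ctrM ctrK => ->; rewrite mulmxA. Qed.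

Lemma psd_congr X M : psd M -> psd (X *m M *m ctr X).
Proof.
move=> [hM pM]; split; first exact: hermitian_congr.
by move=> v; rewrite -/(qform _ _) qform_congr; exact: pM.
Qed.

Lemma psd_congrE X M : X \in unitmx -> psd (X *m M *m ctr X) <-> psd M.
Proof.
move=> uX; split; last exact: psd_congr.
by move=> /(psd_congr (invmx X)); rewrite (congrK _ uX).
Qed.

Lemma posdef_congr X M : X \in unitmx -> posdef M -> posdef (X *m M *m ctr X).
Proof.
move=> uX [hM pM]; split; first exact: hermitian_congr.
have uX' : ctr X \in unitmx by rewrite ctr_unitmx.
move=> v v0; rewrite -/(qform _ _) qform_congr; apply: pM.
apply: contra_neq v0 => /(congr1 (mulmx (invmx (ctr X)))).
by rewrite mulmxA (mulVmx uX') mul1mx mulmx0.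
Qed.

Lemma qform_rdiag_delta d k : qform (rdiag d) (delta_mx k 0) = (d k)%:C.
Proof.
rewrite qform_rdiag (bigD1 k) //= big1 ?addr0 => [|i ik].
  by rewrite !mxE !eqxx -[X in _ * X]/(1 * conjc 1) conjc1 !mulr1.
by rewrite !mxE (negbTE ik) /= mul0r mulr0.
Qed.

Lemma psd_rdiagP d : psd (rdiag d) <-> forall i, 0 <= d i.
Proof.
split=> [[_ p] i|d0].
  by have := p (delta_mx i 0); rewrite -/(qform _ _) qform_rdiag_delta ler0c.
split; first exact: ctr_rdiag.
move=> v; rewrite -/(qform _ _) qform_rdiag sumr_ge0 // => i _.
by rewrite mulr_ge0 ?mulcJ_ge0 ?ler0c.
Qed.

Lemma posdef_rdiagP d : posdef (rdiag d) <-> forall i, 0 < d i.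
Proof.
split=> [[_ p] i|d0].
  have := p (delta_mx i 0); rewrite -/(qform _ _) qform_rdiag_delta ltcR; apply.
  by apply/eqP => /matrixP /(_ i 0) /eqP; rewrite !mxE !eqxx oner_eq0.
split; first exact: ctr_rdiag.
move=> v v0; rewrite -/(qform _ _) qform_rdiag.
have [i vi0] : exists i, v i 0 != 0.
  apply/existsP; apply: contraNT v0; rewrite negb_exists => /forallP v0.
  by apply/eqP/colP => i; rewrite mxE; apply/eqP; rewrite -[_ == _]negbK.
rewrite (bigD1 i) //= ltr_wpDr //.
  by rewrite sumr_ge0 // => j _; rewrite mulr_ge0 ?mulcJ_ge0 ?ler0c // ltW.
by rewrite mulr_gt0 ?ltcR // lt_neqAle mulcJ_ge0 andbT eq_sym mulf_neq0 // conjc_eq0.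
Qed.

(** * Spectral theorem and simultaneous diagonalization by congruence *)

Lemma hermitian_diag M : hermitian M ->
  exists U d, ctr U *m U = 1%:M /\ M = ctr U *m rdiag d *m U.
Proof.
move=> hM; have hsM : M \is hermsymmx.
  (* Membership in [hermsymmx] carries a sign [(-1) ^+ 0], which is removed here. *)
  by apply/is_hermitianmxP; rewrite expr0 scale1r -map_trmx; symmetry.
have /orthomx_spectralP := hermitian_normalmx hsM.
have := hermitian_spectral_diag_real hsM.
have := spectral_unitarymx M; move: (spectralmx M) (spectral_diag M) => U s uU /mxOverP sR.
have ctrU : invmx U = ctr U by rewrite invmx_unitary // -map_trmx.
move=> MU; exists U, (fun i => complex.Re (s 0 i)); split.
  by rewrite -ctrU (mulVmx (unitarymx_unit uU)).
rewrite -ctrU {1}MU; congr (_ *m diag_mx _ *m _).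
by apply/rowP => i; rewrite mxE RRe_real.
Qed.

(** With [M = U^* D U] and [U] unitary, the entries of [D] are positive, so [P = U^* sqrt D]
    works. *)
Lemma posdef_factor M : posdef M ->
  exists2 P, P \in unitmx & M = P *m ctr P.
Proof.
move=> pM; have [U [d [UU MU]]] := hermitian_diag pM.1.
have uU : U \in unitmx by apply: (mulmx1_unit UU).2.
have d0 : forall i, 0 < d i.
  apply/posdef_rdiagP; have := posdef_congr uU pM.
  by rewrite MU !mulmxA (mulmx1C UU) mul1mx -mulmxA (mulmx1C UU) mulmx1.
exists (ctr U *m rdiag (fun i => Num.sqrt (d i))).
  rewrite unitmx_mul ctr_unitmx uU /=.
  apply: (mulmx1_unit (rdiag_mulV _)).1 => i; by rewrite gt_eqF ?sqrtr_gt0.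
rewrite ctrM ctrK ctr_rdiag MU -!mulmxA; congr (_ *m _).
rewrite mulmxA rdiagM; congr (_ *m _); apply: eq_rdiag => i.
by rewrite -expr2 sqr_sqrtr // ltW.
Qed.

Lemma posdef_unitmx M : posdef M -> M \in unitmx.
Proof.
by move=> /posdef_factor [P uP ->]; rewrite unitmx_mul uP ctr_unitmx.
Qed.

(** Write [A = Q Q^*] and diagonalize [Q^-1 B Q^-*] by a unitary [U]. Then [P = Q U^*] diagonalizes
    [B], and [P P^*] is still [A] because [U^* U = 1]. *)
Lemma posdef_hermitian_diag A B : posdef A -> hermitian B ->
  exists P d, [/\ P \in unitmx, A = P *m ctr P & B = P *m rdiag d *m ctr P].
Proof.
move=> /posdef_factor [Q uQ ->] hB.
have [U [d [UU BU]]] := hermitian_diag (hermitian_congr (invmx Q) hB).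
have uU : U \in unitmx by apply: (mulmx1_unit UU).2.
exists (Q *m ctr U), d; rewrite unitmx_mul uQ ctr_unitmx; split => //.
  by rewrite ctrM ctrK -mulmxA (mulmxA (ctr U)) UU mul1mx.
have /(congr1 (fun X => Q *m X *m ctr Q)) := BU.
by rewrite (congrVK _ uQ) => ->; rewrite ctrM ctrK !mulmxA.
Qed.

(** * Spectra of matrices similar to a real diagonal matrix *)

Lemma rspec_rdiag P d : P \in unitmx ->
  rspec (P *m rdiag d *m invmx P) = range d.
Proof.
move=> uP; apply/seteqP; split=> [x /eigenvalueP [v vM v0]|_ [i _ <-]].
  (* Eigenvectors are row vectors, so [w] is a left eigenvector of [rdiag d]; any nonzero coordinate
     [w 0 i] forces [x = d i]. *)
  pose w := v *m P.
  have w0 : w != 0.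
    by apply: contra_neq v0 => /(congr1 (mulmx^~ (invmx P))); rewrite (mulmxK uP) mul0mx.
  have wD : w *m rdiag d = x%:C *: w.
    by rewrite /w scalemxAl -vM !mulmxA (mulmxKV uP).
  have [i wi0] : exists i, w 0 i != 0.
    apply/existsP; apply: contraNT w0; rewrite negb_exists => /forallP w0.
    by apply/eqP/rowP => i; rewrite [RHS]mxE; apply/eqP; rewrite -[_ == _]negbK.
  exists i => //; apply: complexI; apply: (mulIf wi0).
  by have /rowP /(_ i) := wD; rewrite mul_mx_diag !mxE mulrC.
apply/eigenvalueP; exists (delta_mx 0 i *m invmx P).
  rewrite !mulmxA (mulmxKV uP) scalemxAl; congr (_ *m _).
  apply/rowP => j; rewrite mul_mx_diag !mxE eqxx /=.
  by case: eqP => [->|_]; rewrite ?mul1r ?mulr1 ?mul0r ?mulr0.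
apply/eqP => /(congr1 (mulmx^~ P)); rewrite (mulmxKV uP) mul0mx.
by move=> /matrixP /(_ 0 i) /eqP; rewrite !mxE !eqxx oner_eq0.
Qed.

(** The product is [P diag(b / a) P^-1], since the factors [ctr P] cancel. A general [a] serves both
    [B A^-1] and [A B^-1]. *)
Lemma rspec_pencil P a b : P \in unitmx -> (forall i, a i != 0) ->
  rspec (P *m rdiag b *m ctr P *m invmx (P *m rdiag a *m ctr P))
  = range (fun i => b i / a i).
Proof.
move=> uP a0; rewrite -(rspec_rdiag _ uP); congr rspec.
have uA : P *m rdiag a *m ctr P \in unitmx.
  rewrite !unitmx_mul uP ctr_unitmx uP andbT /=.
  exact: (mulmx1_unit (rdiag_mulV a0)).1.
apply: (canLR (mulmxK uA)).
rewrite !mulmxA (mulmxKV uP) -(mulmxA P (rdiag _) (rdiag _)) rdiagM.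
by rewrite (eq_rdiag (b := b)) // => i; rewrite divfK.
Qed.

(** * The Loewner order *)

Lemma loewner_congr X A B : X \in unitmx ->
  loewner (X *m A *m ctr X) (X *m B *m ctr X) <-> loewner A B.
Proof. by move=> uX; rewrite /loewner -mulmxBl -mulmxBr; exact: psd_congrE. Qed.

Lemma loewner_rdiag a b : loewner (rdiag a) (rdiag b) <-> forall i, a i <= b i.
Proof.
rewrite /loewner rdiagB psd_rdiagP.
by split=> ab i; have := ab i; rewrite subr_ge0.
Qed.

Lemma loewner_trans A B M : loewner A B -> loewner B M -> loewner A M.
Proof.
move=> [hAB pAB] [hBM pBM]; rewrite /loewner.
have -> : M - A = (B - A) + (M - B) by rewrite [RHS]addrC addrA subrK.
have ctrD : {morph (@ctr R n) : X Y / X + Y}.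
  by move=> X Y; rewrite /ctr map_mxD linearD.
split=> [|v]; first by rewrite /Defs.hermitian ctrD hAB hBM.
by rewrite mulmxDr mulmxDl mxE addr_ge0.
Qed.

Lemma ctrZ t X : ctr (t%:C *: X) = t%:C *: ctr X.
Proof.
by rewrite /ctr map_mxZ linearZ; congr (_ *: _); exact: conjc_real.
Qed.

Lemma loewnerZ t A B : 0 <= t -> loewner A B -> loewner (t%:C *: A) (t%:C *: B).
Proof.
move=> t0 [hAB pAB]; rewrite /loewner -scalerBr; split.
  by rewrite /Defs.hermitian ctrZ hAB.
by move=> v; rewrite -scalemxAr -scalemxAl mxE mulr_ge0 ?ler0c.
Qed.

Lemma posdefZ t A : 0 < t -> posdef A -> posdef (t%:C *: A).
Proof.
move=> t0 [hA pA]; split; first by rewrite /Defs.hermitian ctrZ hA.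
by move=> v v0; rewrite -scalemxAr -scalemxAl mxE mulr_gt0 ?ltcR ?pA.
Qed.

Lemma posdef1 : posdef (1%:M : 'M[C]_n).
Proof. by rewrite -rdiag1; apply/posdef_rdiagP. Qed.

End Dim.

(** * Attained extrema of real families *)

Lemma sup_range (I : Type) (f : I -> R) k :
  (forall i, f i <= f k) -> sup (range f) = f k.
Proof.
move=> fk; apply/eqP; rewrite eq_le; apply/andP; split.
  by apply: ge_sup; [exists (f k), k | move=> _ [i _ <-]].
apply: ub_le_sup; last by exists k.
by exists (f k) => _ [i _ <-].
Qed.

Lemma inf_range (I : Type) (f : I -> R) k :
  (forall i, f k <= f i) -> inf (range f) = f k.
Proof.
move=> fk; apply/eqP; rewrite eq_le; apply/andP; split.
  apply: ge_inf; last by exists k.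
  by exists (f k) => _ [i _ <-].
by apply: lb_le_inf; [exists (f k), k | move=> _ [i _ <-]].
Qed.

Lemma ord_extrema n (d : 'I_n -> R) : (0 < n)%N ->
  exists k l, forall i, d k <= d i <= d l.
Proof.
case: n d => // n d _.
exists [arg min_(i < ord0) d i]%O, [arg max_(i > ord0) d i]%O => i.
case: arg_minP => // k _ kmin; case: arg_maxP => // l _ lmax.
by rewrite kmin //; exact: lmax.
Qed.

(** * Extreme eigenvalues of [B A^-1] and the shape of [mstar A B] *)

Section Pencil.
Variables (n : nat) (n_gt0 : (0 < n)%N).
Implicit Types (A B M P X : 'M[C]_n) (d a b : 'I_n -> R) (t : R).

Lemma lmax_pencil P a b k : P \in unitmx -> (forall i, a i != 0) ->
  (forall i, b i / a i <= b k / a k) ->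
  lmax (P *m rdiag b *m ctr P *m invmx (P *m rdiag a *m ctr P)) = b k / a k.
Proof.
by move=> uP a0 abk; rewrite /lmax rspec_pencil // (sup_range abk).
Qed.

Lemma lmin_pencil P a b k : P \in unitmx -> (forall i, a i != 0) ->
  (forall i, b k / a k <= b i / a i) ->
  lmin (P *m rdiag b *m ctr P *m invmx (P *m rdiag a *m ctr P)) = b k / a k.
Proof.
by move=> uP a0 abk; rewrite /lmin rspec_pencil // (inf_range abk).
Qed.

(** The normal form that reduces statements on a pair to positive numbers [d i]. [A] is written with
    the constant diagonal 1 so that both matrices fit the pencil lemmas. *)
Lemma posdef_pair_diag A B : posdef A -> posdef B -> exists P d k l,
  [/\ [/\ P \in unitmx, A = P *m rdiag (fun=> 1) *m ctr P & B = P *m rdiag d *m ctr P],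
      lmin (B *m invmx A) = d k, lmax (B *m invmx A) = d l,
      forall i, 0 < d i & forall i, d k <= d i <= d l].
Proof.
move=> pA pB; have [P [d [uP AP BP]]] := posdef_hermitian_diag pA pB.1.
have [k [l kl]] := ord_extrema d n_gt0; exists P, d, k, l.
have AP1 : A = P *m rdiag (fun=> 1) *m ctr P by rewrite rdiag1 mulmx1.
split=> [||||i]; last exact: kl.
- by split.
- rewrite BP AP1 (lmin_pencil (k := k)) ?divr1 // => i; rewrite ?oner_neq0 //.
  by rewrite !divr1; case/andP: (kl i).
- rewrite BP AP1 (lmax_pencil (k := l)) ?divr1 // => i; rewrite ?oner_neq0 //.
  by rewrite !divr1; case/andP: (kl i).
- apply/posdef_rdiagP; rewrite -[rdiag d](congrK _ uP) -BP.
  by apply: posdef_congr pB; rewrite unitmx_inv.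
Qed.

Lemma lmin_gt0 A B : posdef A -> posdef B -> 0 < lmin (B *m invmx A).
Proof. by move=> pA pB; have [P [d [k [l [_ -> _ d0 _]]]]] := posdef_pair_diag pA pB. Qed.

Lemma lmax_gt0 A B : posdef A -> posdef B -> 0 < lmax (B *m invmx A).
Proof. by move=> pA pB; have [P [d [k [l [_ _ -> d0 _]]]]] := posdef_pair_diag pA pB. Qed.

Lemma scale_pencil P d t :
  t%:C *: (P *m rdiag d *m ctr P) = P *m rdiag (fun i => t * d i) *m ctr P.
Proof. by rewrite -rdiagZ -scalemxAr -scalemxAl. Qed.

(** In the common diagonal form both sides say that every [d i] is at most [t]. Bounds on [lmax] can
    then be chained by transitivity of the order. *)
Lemma lmax_leP A B t : posdef A -> posdef B ->
  lmax (B *m invmx A) <= t <-> loewner B (t%:C *: A).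
Proof.
move=> pA pB; have [P [d [k [l [[uP AP BP] _ -> d0 kl]]]]] := posdef_pair_diag pA pB.
rewrite AP scale_pencil BP (loewner_congr _ _ uP) loewner_rdiag.
split=> [dt i|/(_ l)]; rewrite mulr1 //.
by case/andP: (kl i) => _ /le_trans; apply.
Qed.

Lemma lmin_geP A B t : posdef A -> posdef B ->
  t <= lmin (B *m invmx A) <-> loewner (t%:C *: A) B.
Proof.
move=> pA pB; have [P [d [k [l [[uP AP BP] -> _ d0 kl]]]]] := posdef_pair_diag pA pB.
rewrite AP scale_pencil BP (loewner_congr _ _ uP) loewner_rdiag.
split=> [dt i|/(_ k)]; rewrite mulr1 //.
by case/andP: (kl i) => dk _; apply: le_trans dt dk.
Qed.

(** The eigenvalues of [A B^-1] are the [1 / d i], the largest coming from the smallest [d i]. *)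
Lemma lmaxV A B : posdef A -> posdef B ->
  lmax (A *m invmx B) = (lmin (B *m invmx A))^-1.
Proof.
move=> pA pB; have [P [d [k [l [[uP AP BP] -> _ d0 kl]]]]] := posdef_pair_diag pA pB.
rewrite AP BP (lmax_pencil (k := k)) ?div1r // => i; first by rewrite gt_eqF.
by rewrite !div1r lef_pV2 ?posrE //; case/andP: (kl i).
Qed.

Lemma lminV A B : posdef A -> posdef B ->
  lmin (A *m invmx B) = (lmax (B *m invmx A))^-1.
Proof. by move=> pA pB; rewrite (lmaxV pB pA) invrK. Qed.

(* The effect of [mstar 1] on an eigenvalue x of a matrix whose extreme
   eigenvalues are m and M. *)
Definition star_eig (m M x : R) : R :=
  (Num.sqrt m + Num.sqrt M)^-1 * (x + Num.sqrt (m * M)).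

(** [m + sqrt (m M) = sqrt m (sqrt m + sqrt M)], and likewise for [M]. *)
Lemma star_eigE (m M : R) : 0 < m -> 0 < M ->
  star_eig m M m = Num.sqrt m /\ star_eig m M M = Num.sqrt M.
Proof.
move=> m0 M0; rewrite /star_eig sqrtrM ?(ltW m0) //.
have sm0 : 0 < Num.sqrt m by rewrite sqrtr_gt0.
have sM0 : 0 < Num.sqrt M by rewrite sqrtr_gt0.
have s0 : Num.sqrt m + Num.sqrt M != 0 by rewrite gt_eqF ?addr_gt0.
split; apply: (canLR (mulKf s0)).
  by rewrite -{1}(sqr_sqrtr (ltW m0)) expr2 -mulrDr mulrC.
by rewrite -{1}(sqr_sqrtr (ltW M0)) expr2 -mulrDl addrC.
Qed.

Lemma star_eig_mono (m M x y : R) : 0 < m -> 0 < M -> x <= y ->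
  star_eig m M x <= star_eig m M y.
Proof.
by move=> m0 M0 xy; rewrite /star_eig ler_wpM2l ?lerD2r.
Qed.

Lemma mstar_pencil P d (m M : R) :
  lmin (P *m rdiag d *m ctr P *m invmx (P *m rdiag (fun=> 1) *m ctr P)) = m ->
  lmax (P *m rdiag d *m ctr P *m invmx (P *m rdiag (fun=> 1) *m ctr P)) = M ->
  mstar (P *m rdiag (fun=> 1) *m ctr P) (P *m rdiag d *m ctr P) =
  P *m rdiag (fun i => star_eig m M (d i)) *m ctr P.
Proof.
move=> mE ME; rewrite /mstar mE ME scale_pencil -mulmxDl -mulmxDr rdiagD scale_pencil.
by congr (_ *m _ *m _); apply: eq_rdiag => i; rewrite mulr1.
Qed.

Lemma mstar_pair_diag A B : posdef A -> posdef B -> exists P d k l,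
  [/\ [/\ P \in unitmx, A = P *m rdiag (fun=> 1) *m ctr P & B = P *m rdiag d *m ctr P],
      lmin (B *m invmx A) = d k, lmax (B *m invmx A) = d l,
      mstar A B = P *m rdiag (fun i => star_eig (d k) (d l) (d i)) *m ctr P &
      (forall i, 0 < d i) /\ forall i, d k <= d i <= d l].
Proof.
move=> pA pB; have [P [d [k [l [[uP AP BP] mE ME d0 kl]]]]] := posdef_pair_diag pA pB.
exists P, d, k, l; split; [by split | exact: mE | exact: ME | | by split].
by rewrite {1}AP {1}BP; apply: mstar_pencil; rewrite -AP -BP.
Qed.

Lemma posdef_mstar A B : posdef A -> posdef B -> posdef (mstar A B).
Proof.
move=> pA pB; have [P [d [k [l [[uP AP BP] _ _ -> [d0 kl]]]]]] := mstar_pair_diag pA pB.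
apply: (posdef_congr uP); apply/posdef_rdiagP => i.
apply: lt_le_trans (star_eig_mono (d0 k) (d0 l) (andP (kl i)).1).
by rewrite (star_eigE _ _).1 ?sqrtr_gt0.
Qed.

(** [star_eig] is nondecreasing, so the index of the largest eigenvalue is kept, and there its value
    is the square root. *)
Lemma lmax_mstar A B : posdef A -> posdef B ->
  lmax (mstar A B *m invmx A) = Num.sqrt (lmax (B *m invmx A)).
Proof.
move=> pA pB; have [P [d [k [l [[uP AP BP] _ -> -> [d0 kl]]]]]] := mstar_pair_diag pA pB.
rewrite AP (lmax_pencil (k := l)) ?divr1 ?(star_eigE _ _).2 // => i; rewrite ?oner_neq0 //.
by rewrite !divr1 -(star_eigE (d0 k) (d0 l)).2 star_eig_mono //; case/andP: (kl i).
Qed.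

Lemma lmin_mstar A B : posdef A -> posdef B ->
  lmin (mstar A B *m invmx A) = Num.sqrt (lmin (B *m invmx A)).
Proof.
move=> pA pB; have [P [d [k [l [[uP AP BP] -> _ -> [d0 kl]]]]]] := mstar_pair_diag pA pB.
rewrite AP (lmin_pencil (k := k)) ?divr1 ?(star_eigE _ _).1 // => i; rewrite ?oner_neq0 //.
by rewrite !divr1 -(star_eigE (d0 k) (d0 l)).1 star_eig_mono //; case/andP: (kl i).
Qed.

(** Swapping the arguments replaces [(m, M)] by [(1 / M, 1 / m)]; the coefficients of [A] and of [B]
    then agree separately. *)
Lemma mstarC A B : posdef A -> posdef B -> mstar A B = mstar B A.
Proof.
move=> pA pB; rewrite /mstar (lmaxV pA pB) (lminV pA pB).
have := lmin_gt0 pA pB; have := lmax_gt0 pA pB.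
move: (lmax _) (lmin _) => M m M0 m0.
rewrite !sqrtrM ?invr_ge0 ?ltW // !sqrtrV ?ltW //.
have sm0 : Num.sqrt m != 0 by rewrite gt_eqF ?sqrtr_gt0.
have sM0 : Num.sqrt M != 0 by rewrite gt_eqF ?sqrtr_gt0.
have s0 : Num.sqrt m + Num.sqrt M != 0 by rewrite gt_eqF ?addr_gt0 ?sqrtr_gt0.
rewrite !scalerDr !scalerA -!rmorphM addrC; congr (_%:C *: _ + _%:C *: _); field.
all: by rewrite ?sm0 ?sM0 ?s0.
Qed.

(** * The Thompson metric and midpoints *)

Lemma dinfE A B : posdef A -> posdef B ->
  dinf A B = Num.max (ln (lmax (B *m invmx A))) (- ln (lmin (B *m invmx A))).
Proof. by move=> pA pB; rewrite /dinf (lmaxV pA pB) lnV // posrE lmin_gt0. Qed.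

Lemma ln_sqrt (x : R) : 0 < x -> ln (Num.sqrt x) = ln x / 2.
Proof.
move=> x0; rewrite -{2}(sqr_sqrtr (ltW x0)) lnXn ?sqrtr_gt0 //.
by rewrite -[X in X / 2]mulr_natr mulfK.
Qed.

Lemma dinf_mstarl A B : posdef A -> posdef B -> dinf A (mstar A B) = dinf A B / 2.
Proof.
move=> pA pB; have pS := posdef_mstar pA pB.
rewrite !dinfE // lmax_mstar // lmin_mstar // !ln_sqrt ?lmax_gt0 ?lmin_gt0 //.
by rewrite -mulNr maxr_pMl.
Qed.

Lemma dinfC A B : dinf A B = dinf B A.
Proof. exact: maxC. Qed.

(** The distance to [B] follows from the distance to [A] by exchanging the roles of [A] and [B], as
    [mstar] and [dinf] are symmetric. *)
Lemma mstar_midpoint A B : posdef A -> posdef B ->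
  dinf A (mstar A B) = dinf (mstar A B) B /\ dinf (mstar A B) B = dinf A B / 2.
Proof.
move=> pA pB; have e : dinf (mstar A B) B = dinf A B / 2.
  by rewrite dinfC (mstarC pA pB) (dinf_mstarl pB pA) dinfC.
by rewrite e (dinf_mstarl pA pB).
Qed.

(** * Behaviour under congruence and scaling *)

Lemma rspec_conjmx X M : X \in unitmx -> rspec (X *m M *m invmx X) = rspec M.
Proof.
move=> uX; have sub (Y N : 'M[C]_n) : Y \in unitmx -> rspec N `<=` rspec (Y *m N *m invmx Y).
  move=> uY x /eigenvalueP [v vN v0]; apply/eigenvalueP; exists (v *m invmx Y).
    by rewrite !mulmxA (mulmxKV uY) vN scalemxAl.
  by apply: contra_neq v0 => /(congr1 (mulmx^~ Y)); rewrite (mulmxKV uY) mul0mx.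
apply/seteqP; split=> [|x]; last exact: sub.
have uX' : invmx X \in unitmx by rewrite unitmx_inv.
by move=> x /(sub _ _ uX'); rewrite invmxK !mulmxA (mulVmx uX) mul1mx (mulmxKV uX).
Qed.

(** A congruence by [X] turns [B A^-1] into the similar matrix [X (B A^-1) X^-1], so the two scalar
    coefficients do not change. *)
Lemma mstar_congr A B X : posdef A -> X \in unitmx ->
  mstar (X *m A *m ctr X) (X *m B *m ctr X) = X *m mstar A B *m ctr X.
Proof.
move=> /posdef_unitmx uA uX.
have uAX : X *m A *m ctr X \in unitmx by rewrite !unitmx_mul uX uA ctr_unitmx.
have eBA : X *m B *m ctr X *m invmx (X *m A *m ctr X) = X *m (B *m invmx A) *m invmx X.
  apply: (canLR (mulmxK uAX)).
  by rewrite !mulmxA (mulmxKV uX) (mulmxKV uA).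
rewrite /mstar /lmax /lmin eBA rspec_conjmx // -scalemxAr -scalemxAl.
by congr (_ *: _); rewrite mulmxDr mulmxDl -scalemxAr -scalemxAl.
Qed.

Lemma lmaxZ t A B : 0 < t -> posdef A -> posdef B ->
  lmax (t%:C *: (B *m invmx A)) = t * lmax (B *m invmx A).
Proof.
move=> t0 pA pB; have [P [d [k [l [[uP AP BP] _ -> d0 kl]]]]] := posdef_pair_diag pA pB.
rewrite scalemxAl AP BP scale_pencil (lmax_pencil (k := l)) ?divr1 // => i;
  rewrite ?oner_neq0 //.
by rewrite !divr1 ler_pM2l //; case/andP: (kl i).
Qed.

Lemma lminZ t A B : 0 < t -> posdef A -> posdef B ->
  lmin (t%:C *: (B *m invmx A)) = t * lmin (B *m invmx A).
Proof.
move=> t0 pA pB; have [P [d [k [l [[uP AP BP] -> _ d0 kl]]]]] := posdef_pair_diag pA pB.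
rewrite scalemxAl AP BP scale_pencil (lmin_pencil (k := k)) ?divr1 // => i;
  rewrite ?oner_neq0 //.
by rewrite !divr1 ler_pM2l //; case/andP: (kl i).
Qed.

(** Scaling [A] by [a] and [B] by [b] multiplies the eigenvalues by [b / a]. The first identity is
    for the coefficient of [B], the second for that of [A]. *)
Lemma star_coef_scale (a b m M : R) : 0 < a -> 0 < b -> 0 < m -> 0 < M ->
  (Num.sqrt (b / a * m) + Num.sqrt (b / a * M))^-1 * b =
    Num.sqrt (a * b) * (Num.sqrt m + Num.sqrt M)^-1 /\
  (Num.sqrt (b / a * m) + Num.sqrt (b / a * M))^-1 *
    Num.sqrt (b / a * m * (b / a * M)) * a =
    Num.sqrt (a * b) * (Num.sqrt m + Num.sqrt M)^-1 * Num.sqrt (m * M).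
Proof.
move=> a0 b0 m0 M0.
have ba0 : 0 <= b / a by rewrite divr_ge0 ?ltW.
rewrite !(sqrtrM _ (mulr_ge0 ba0 (ltW m0))) !(sqrtrM _ ba0) !(sqrtrM _ (ltW b0)).
rewrite (sqrtrM _ (ltW m0)) (sqrtrM _ (ltW a0)) (sqrtrV (ltW a0)).
have := sqr_sqrtr (ltW a0); have := sqr_sqrtr (ltW b0).
have : Num.sqrt a != 0 by rewrite gt_eqF ?sqrtr_gt0.
have : Num.sqrt b != 0 by rewrite gt_eqF ?sqrtr_gt0.
have : Num.sqrt m + Num.sqrt M != 0 by rewrite gt_eqF ?addr_gt0 ?sqrtr_gt0.
(* Replacing [a] and [b] by squares of their roots leaves rational identities for [field]. *)
move: (Num.sqrt a) (Num.sqrt b) (Num.sqrt m) (Num.sqrt M) => sa sb sm sM s0 sb0 sa0 <- <-.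
have -> : (sb / sa * sm + sb / sa * sM)^-1 = sa / (sb * (sm + sM)).
  by field; rewrite sa0 sb0 s0 -mulrDr mulf_neq0.
by split; field; rewrite ?sa0 ?sb0 s0.
Qed.

Lemma mstarZ (a b : R) A B : 0 < a -> 0 < b -> posdef A -> posdef B ->
  mstar (a%:C *: A) (b%:C *: B) = (Num.sqrt (a * b))%:C *: mstar A B.
Proof.
move=> a0 b0 pA pB; have aC0 : a%:C != 0 :> C by rewrite (inj_eq (@complexI R)) gt_eqF.
have e : (b%:C *: B) *m invmx (a%:C *: A) = (b / a)%:C *: (B *m invmx A).
  have uA := posdef_unitmx pA; have uaA := posdef_unitmx (posdefZ a0 pA).
  apply: (canLR (mulmxK uaA)).
  by rewrite -scalemxAr -scalemxAl (mulmxKV uA) scalerA -rmorphM mulrC divfK ?gt_eqF.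
have ba0 : 0 < b / a by rewrite divr_gt0.
rewrite /mstar e lmaxZ // lminZ //.
have [eB eA] := star_coef_scale a0 b0 (lmin_gt0 pA pB) (lmax_gt0 pA pB).
by rewrite !scalerDr !scalerA -!rmorphM eB eA.
Qed.

(** * Betweenness and eigenvalue monotonicity *)

Lemma mstar_between A B : posdef A -> posdef B -> loewner A B ->
  loewner A (mstar A B) /\ loewner (mstar A B) B.
Proof.
move=> pA pB; have [P [d [k [l [[uP AP BP] _ _ -> [d0 kl]]]]]] := mstar_pair_diag pA pB.
rewrite AP BP !(loewner_congr _ _ uP) !loewner_rdiag => /= d1.
have [sm sM] := star_eigE (d0 k) (d0 l).
(* [loewner A B] has become [1 <= d i] for all [i]; the lower bound then follows from
   [star_eig >= sqrt (d k) >= 1]. *)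
have sqrt_d1 i : 1 <= Num.sqrt (d i) by rewrite -[leLHS]sqrtr1 ler_wsqrtr.
have [sk1 sl1] := (sqrt_d1 k, sqrt_d1 l).
split=> i; case/andP: (kl i) => ki il.
  apply: le_trans (star_eig_mono (d0 k) (d0 l) ki); by rewrite sm.
rewrite /star_eig mulrC ler_pdivrMr ?addr_gt0 ?sqrtr_gt0 // sqrtrM ?(ltW (d0 k)) //.
have := sqr_sqrtr (ltW (d0 k)); have := ki.
move: (Num.sqrt (d k)) (Num.sqrt (d l)) sk1 sl1 => s S s1 S1 + ss; rewrite -ss => sdi.
have di1 := d1 i; rewrite -subr_ge0.
(* Both summands are nonnegative: [s >= 1], and [d i >= d k = s ^+ 2 >= s]. *)
have -> : d i * (s + S) - (d i + s * S) = (s - 1) * d i + S * (d i - s) by ring.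
rewrite addr_ge0 ?mulr_ge0 ?subr_ge0 //; first exact: le_trans di1.
  exact: le_trans S1.
apply: le_trans sdi; rewrite expr2 ler_peMr //; exact: le_trans s1.
Qed.

(** The factor [invmx 1%:M] is kept so that [lmax_leP] applies with the identity as first matrix. *)
Lemma lmax_mstar1 A : posdef A -> lmax (mstar 1%:M A) = Num.sqrt (lmax (A *m invmx 1%:M)).
Proof. by move=> pA; rewrite -(lmax_mstar (posdef1 n) pA) [in RHS]invmx1 mulmx1. Qed.

Lemma lmin_mstar1 A : posdef A -> lmin (mstar 1%:M A) = Num.sqrt (lmin (A *m invmx 1%:M)).
Proof. by move=> pA; rewrite -(lmin_mstar (posdef1 n) pA) [in RHS]invmx1 mulmx1. Qed.

Lemma mstar1_mono A B : posdef A -> posdef B -> loewner A B ->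
  lmax (mstar 1%:M A) <= lmax (mstar 1%:M B) /\
  lmin (mstar 1%:M A) <= lmin (mstar 1%:M B).
Proof.
move=> pA pB AB; have p1 := posdef1 n; split.
  rewrite [leLHS](lmax_mstar1 pA) [leRHS](lmax_mstar1 pB); apply: ler_wsqrtr.
  apply/(lmax_leP _ p1 pA); apply: loewner_trans AB _.
  exact/(lmax_leP _ p1 pB).
rewrite [leLHS](lmin_mstar1 pA) [leRHS](lmin_mstar1 pB); apply: ler_wsqrtr.
apply/(lmin_geP _ p1 pB); apply: loewner_trans AB.
exact/(lmin_geP _ p1 pA).
Qed.

(* In the Thompson metric: ln lmax is 1-Lipschitz in each of the two matrices. *)
Lemma lmax_le_scale A B A' B' t : 0 < t -> posdef A -> posdef B -> posdef A' -> posdef B' ->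
  loewner A' (t%:C *: A) -> loewner B (t%:C *: B') ->
  lmax (B *m invmx A) <= t ^+ 2 * lmax (B' *m invmx A').
Proof.
move=> t0 pA pB pA' pB' lA lB; apply/(lmax_leP _ pA pB).
have := (lmax_leP (lmax (B' *m invmx A')) pA' pB').1 (lexx _).
have := lmax_gt0 pA' pB'; move: (lmax (B' *m invmx A')) => M M0 B'M.
(* The chain is [B <= t B' <= t M A' <= t^2 M A] in the Loewner order. *)
apply: loewner_trans lB _; apply: loewner_trans (loewnerZ (ltW t0) B'M) _.
have := loewnerZ (ltW (mulr_gt0 t0 M0)) lA.
by rewrite !scalerA -!rmorphM expr2 (mulrAC t M).
Qed.

End Pencil.
End ComplexMatrices.

(** * Continuity, by comparing nearby matrices in the Loewner order *)

Section Continuity.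
Variables (R : realType) (n : nat) (n_gt0 : (0 < n)%N).
Local Notation MC := 'M[R[i]^o]_n.
Implicit Types (A B : MC).

Lemma cvg_real_complex (T : Type) (F : set_system T) (f : T -> R) (l : R) :
  Filter F -> f x @[x --> F] --> l ->
  ((f x)%:C : R[i]^o) @[x --> F] --> (l%:C : R[i]^o).
Proof.
move=> FF /cvgrPdist_lt fl; apply/cvgrPdist_lt => e e0.
(* The radius [e] is a complex number; being positive, it is real. *)
have eE : e = (complex.Re e)%:C by rewrite RRe_real // gtr0_real.
have : 0 < complex.Re e by rewrite -ltcR -eE.
move=> /fl; apply: filterS => x lx.
rewrite -[_ - _](rmorphB (real_complex R)) normc_def /= expr0n addr0 sqrtr_sqr.
by rewrite eE ltcR.
Qed.

Definition congr_dev A0 A : R[i]^o :=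
  \tr ((A *m invmx A0 - 1%:M) *m (A *m invmx A0 - 1%:M)).

Lemma cvg_congr_dev (T : Type) (F : set_system T) (f : T -> MC) A0 A :
  Filter F -> f x @[x --> F] --> A ->
  congr_dev A0 (f x) @[x --> F] --> congr_dev A0 A.
Proof.
move=> FF fA.
have coord i j : (f x i j : R[i]^o) @[x --> F] --> (A i j : R[i]^o).
  by apply: (cvg_comp f (fun X : MC => X i j : R[i]^o)) fA _; exact: coord_continuous.
have entry i j : ((f x *m invmx A0 - 1%:M) i j : R[i]^o) @[x --> F] -->
    ((A *m invmx A0 - 1%:M) i j : R[i]^o).
  under eq_fun do rewrite !mxE; rewrite !mxE.
  apply: cvgB; last exact: cvg_cst.
  apply: (cvg_big add_continuous) => k _.
  by apply: cvgM; [exact: coord | exact: cvg_cst].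
apply: (cvg_big add_continuous) => i _.
under eq_fun do rewrite mxE; rewrite mxE.
apply: (cvg_big add_continuous) => k _.
by apply: cvgM; exact: entry.
Qed.

(** [A A0^-1 - 1] equals [P diag(d - 1) P^-1], and the trace of its square is invariant under
    similarity. *)
Lemma congr_devE (P : 'M[R[i]]_n) (d : 'I_n -> R) : P \in unitmx ->
  congr_dev (P *m ctr P) (P *m rdiag d *m ctr P) = (\sum_i (d i - 1) ^+ 2)%:C.
Proof.
move=> uP; rewrite /congr_dev.
have uPP : P *m ctr P \in unitmx by rewrite unitmx_mul uP ctr_unitmx.
have -> : P *m rdiag d *m ctr P *m invmx (P *m ctr P) - 1%:M
  = P *m rdiag (fun i => d i - 1) *m invmx P.
  rewrite -rdiagB rdiag1 mulmxBr mulmxBl mulmx1 (mulmxV uP); congr (_ - _).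
  by apply: (canLR (mulmxK uPP)); rewrite !mulmxA (mulmxKV uP).
rewrite mxtrace_mulC !mulmxA (mulmxKV uP) -(mulmxA P) rdiagM mxtrace_mulC !mulmxA.
rewrite (mulVmx uP) mul1mx mxtrace_diag rmorph_sum.
by apply: eq_bigr => i _; rewrite mxE expr2.
Qed.

Lemma loewner_near A0 (t : R) : posdef A0 -> 1 < t ->
  \forall A \near A0, posdef A ->
    loewner A (t%:C *: A0) /\ loewner A0 (t%:C *: A).
Proof.
move=> pA0 t1; have t0 : 0 < t by apply: lt_trans t1.
have dev0 : congr_dev A0 A0 = 0.
  by rewrite /congr_dev (mulmxV (posdef_unitmx pA0)) subrr mul0mx mxtrace0.
(* [|d i - 1| < e] gives [d i > 1 / t] and [d i < 2 - 1 / t]; the latter bound is at most [t]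
   because [t + 1 / t >= 2]. *)
pose e := 1 - t^-1.
have e0 : 0 < e by rewrite subr_gt0 invf_lt1.
have e2C : 0 < (e ^+ 2)%:C :> R[i] by rewrite ltcR exprn_gt0.
have := cvg_congr_dev (A0 := A0) (f := id) (nbhs_filter A0) cvg_id; rewrite dev0.
move=> /cvgr0Pnorm_lt /(_ _ e2C).
apply: filterS => A dA pA.
have [P [d [uP A0P AP]]] := posdef_hermitian_diag pA0 pA.1.
have d1 i : `|d i - 1| < e.
  rewrite -(ltr_pXn2r (n := 2)) ?nnegrE ?normr_ge0 ?(ltW e0) // real_normK ?num_real //.
  move: dA; rewrite {1}A0P {1}AP congr_devE // normc_def /= expr0n addr0 sqrtr_sqr ltcR.
  move=> /(le_lt_trans (ler_norm _)); apply: le_lt_trans.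
  by rewrite (bigD1 i) //= lerDl sumr_ge0 // => j _; rewrite sqr_ge0.
have A0P1 : A0 = P *m rdiag (fun=> 1) *m ctr P by rewrite rdiag1 mulmx1.
rewrite A0P1 AP !scale_pencil !(loewner_congr _ _ uP) !loewner_rdiag.
split=> i; have := d1 i; rewrite ltr_norml /e => /andP[].
  move=> _ di; apply: le_trans (_ : 2 - t^-1 <= _); first lra.
  rewrite mulr1 -subr_ge0.
  have -> : t - (2 - t^-1) = (t - 1) ^+ 2 / t by field; rewrite gt_eqF.
  by rewrite divr_ge0 ?sqr_ge0 ?ltW.
move=> di _; have tdi : t^-1 <= d i by lra.
by rewrite mulrC -ler_pdivrMr // div1r.
Qed.

Section Limits.
Variables (T : Type) (F : set_system T) (FF : Filter F).
Implicit Types f g : T -> MC.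

Lemma cvg_lmax f g A B : posdef A -> posdef B ->
  f x @[x --> F] --> A -> g x @[x --> F] --> B ->
  (\forall x \near F, posdef (f x) /\ posdef (g x)) ->
  lmax (g x *m invmx (f x)) @[x --> F] --> lmax (B *m invmx A).
Proof.
move=> pA pB fA gB pfg; apply/cvgrPdist_le => e e0.
pose M := lmax (B *m invmx A); have M0 : 0 < M := lmax_gt0 n_gt0 pA pB.
(* Chosen so that [s * M = M + e]. Each matrix is compared with its limit up to the factor [sqrt s],
   and the two factors multiply to [s]. *)
pose s := 1 + e / M.
have s1 : 1 < s by rewrite ltrDl divr_gt0.
have t1 : 1 < Num.sqrt s by rewrite -[ltLHS]sqrtr1 ltr_sqrt // (lt_trans ltr01).
have t0 : 0 < Num.sqrt s := lt_trans ltr01 t1.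
have t2 : Num.sqrt s ^+ 2 = s by rewrite sqr_sqrtr // ltW // (lt_trans ltr01).
have near_le h (L : MC) : posdef L -> h x @[x --> F] --> L -> \forall x \near F,
    posdef (h x) -> loewner (h x) ((Num.sqrt s)%:C *: L) /\
                    loewner L ((Num.sqrt s)%:C *: h x).
  by move=> pL hL; exact: hL _ (loewner_near pL t1).
have near_dist N : N <= s * M -> M <= s * N -> `|M - N| <= e.
  have sM : s * M = M + e by rewrite /s mulrDl mul1r divfK // gt_eqF.
  move=> NM MN; rewrite ler_norml; apply/andP; split; first by rewrite sM in NM; lra.
  have [|NltM] := leP M N; first by lra.
  suff : s * N <= N + e by lra.
  (* Here [N < M], so the excess [e / M * N] is at most [e]. *)
  by rewrite /s mulrDl mul1r lerD2l mulrAC ler_pdivrMr // ler_pM2l // ltW.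
have nA := near_le f A pA fA; have nB := near_le g B pB gB.
apply: filterS (filterI pfg (filterI nA nB)) => x [[pf pg] [Ax Bx]].
have [fA1 Af] := Ax pf; have [gB1 Bg] := Bx pg.
apply: near_dist; rewrite -t2.
  exact: (lmax_le_scale n_gt0 t0 pf pg pA pB Af gB1).
exact: (lmax_le_scale n_gt0 t0 pA pB pf pg fA1 Bg).
Qed.

(** [lmin (B A^-1)] is the inverse of [lmax (A B^-1)], whose limit is nonzero. *)
Lemma cvg_lmin f g A B : posdef A -> posdef B ->
  f x @[x --> F] --> A -> g x @[x --> F] --> B ->
  (\forall x \near F, posdef (f x) /\ posdef (g x)) ->
  lmin (g x *m invmx (f x)) @[x --> F] --> lmin (B *m invmx A).
Proof.
move=> pA pB fA gB pfg; rewrite (lminV n_gt0 pB pA).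
have gfpos : \forall x \near F, posdef (g x) /\ posdef (f x).
  by apply: filterS pfg => x [].
have M0 : lmax (A *m invmx B) != 0 by rewrite gt_eqF ?(lmax_gt0 n_gt0 pB pA).
apply: cvg_trans (cvgV M0 (cvg_lmax pB pA gB fA gfpos)).
apply: near_eq_cvg; apply: filterS pfg => x [pf pg] /=.
by rewrite (lminV n_gt0 pg pf).
Qed.

Lemma cvg_mstar f g A B : posdef A -> posdef B ->
  f x @[x --> F] --> A -> g x @[x --> F] --> B ->
  (\forall x \near F, posdef (f x) /\ posdef (g x)) ->
  (mstar (f x) (g x) : MC) @[x --> F] --> (mstar A B : MC).
Proof.
move=> pA pB fA gB pfg.
have cM := cvg_lmax pA pB fA gB pfg; have cm := cvg_lmin pA pB fA gB pfg.
have csqrt (h : T -> R) l : h x @[x --> F] --> l -> Num.sqrt (h x) @[x --> F] --> Num.sqrt l.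
  by move=> hl; apply: (continuous_cvg FF) hl; exact: sqrt_continuous.
apply: cvgZ.
  apply: cvg_real_complex; apply: cvgV; last by apply: cvgD; exact: csqrt.
  rewrite gt_eqF // addr_gt0 ?sqrtr_gt0 //.
    exact: lmin_gt0.
  exact: lmax_gt0.
apply: (cvgD gB); apply: (cvgZ _ fA); apply: cvg_real_complex; apply: csqrt.
exact: (cvgM cm cM).
Qed.

End Limits.

Lemma mstar_continuous :
  {within [set AB : MC * MC | posdef AB.1 /\ posdef AB.2],
     continuous (fun AB : MC * MC => (mstar AB.1 AB.2 : MC))}.
Proof.
apply/subspace_continuousP => -[A B] /= [pA pB].
apply: (cvg_mstar (f := fst) (g := snd) _ pA pB).
- by apply: cvg_within_filter; exact: cvg_fst.
- by apply: cvg_within_filter; exact: cvg_snd.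
(* Positive definiteness of both components holds along the filter, which is restricted to that
   set. *)
- exact: withinT.
Qed.

End Continuity.

Theorem theorem1 (R : realType) (n : nat) (hn : (0 < n)%N) :
  (* (1) midpoint *)
  (forall A B : 'M[R[i]]_n, posdef A -> posdef B ->
     dinf A (mstar A B) = dinf (mstar A B) B /\
     dinf (mstar A B) B = dinf A B / 2) /\
  (* (2) continuity of mu on P(n) x P(n) *)
  (* (matrices over R[i]^o, i.e. R[i] with its normed topology, entrywise) *)
  {within [set AB : 'M[R[i]^o]_(n,n) * 'M[R[i]^o]_(n,n) | posdef AB.1 /\ posdef AB.2],
     continuous (fun AB : 'M[R[i]^o]_(n,n) * 'M[R[i]^o]_(n,n) =>
                   (mstar AB.1 AB.2 : 'M[R[i]^o]_(n,n)))} /\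
  (* (3) symmetry *)
  (forall A B : 'M[R[i]]_n, posdef A -> posdef B -> mstar A B = mstar B A) /\
  (* (4) congruence invariance *)
  (forall (A B X : 'M[R[i]]_n), posdef A -> posdef B -> X \in unitmx ->
     mstar (X *m A *m ctr X) (X *m B *m ctr X) = X *m mstar A B *m ctr X) /\
  (* (5) homogeneity *)
  (forall (a b : R) (A B : 'M[R[i]]_n), 0 < a -> 0 < b -> posdef A -> posdef B ->
     mstar (a%:C *: A) (b%:C *: B) = (Num.sqrt (a * b))%:C *: mstar A B) /\
  (* (6) monotonicity / betweenness *)
  (forall A B : 'M[R[i]]_n, posdef A -> posdef B -> loewner A B ->
     loewner A (mstar A B) /\ loewner (mstar A B) B) /\
  (* (7) eigenvalue monotonicity *)
  (forall S1 S2 : 'M[R[i]]_n, posdef S1 -> posdef S2 -> loewner S1 S2 ->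
     lmax (mstar 1%:M S1) <= lmax (mstar 1%:M S2) /\
     lmin (mstar 1%:M S1) <= lmin (mstar 1%:M S2)).
Proof.
split; first exact: mstar_midpoint.
split; first exact: mstar_continuous.
split; first exact: mstarC.
split; first by move=> A B X pA _; exact: mstar_congr.
split; first exact: mstarZ.
split; first exact: mstar_between.
exact: mstar1_mono.
Qed.
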